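(* Let $\mathbf H=(\underline H,\overline H,\tau)$ be a weak braided bimonad on a Cauchy complete category $\mathbb A$. Then the quintuple $(H^{\bar\xi},m^{\bar\xi},e^{\bar\xi};\delta_{\bar\xi},\varepsilon_{\bar\xi})$ is a Frobenius separable (co)monad, i.e. $(H^{\bar\xi},m^{\bar\xi},e^{\bar\xi})$ is a monad, $(H^{\bar\xi},\delta_{\bar\xi},\varepsilon_{\bar\xi})$ is a comonad, $H^{\bar\xi}m^{\bar\xi}\cdot\delta_{\bar\xi}H^{\bar\xi}=\delta_{\bar\xi}\cdot m^{\bar\xi}=m^{\bar\xi}H^{\bar\xi}\cdot H^{\bar\xi}\delta_{\bar\xi}$, and $m^{\bar\xi}\cdot\delta_{\bar\xi}=1$.
   Context: Conventions. $\cdot$ is vertical composition of natural transformations; juxtaposition is composition of functors and whiskering, and $\varphi\psi$ is the horizontal composite of $\varphi,\psi$. $1$ is the identity. Cauchy complete means every idempotent splits. Weak YB-pair. For $H:\mathbb A\to\mathbb A$, natural transformations $\tau,\tau':HH\to HH$ form a weak YB-pair if $\tau\tau'\tau=\tau$, $\tau'\tau\tau'=\tau'$, $\tau\cdot\tau'=\tau'\cdot\tau$; $H\tau\cdot\tau H\cdot H\tau=\tau H\cdot H\tau\cdot\tau H$ and the same for $\tau'$; and, with $\nabla:=\tau\cdot\tau'$, $\tau H\cdot H\nabla=H\nabla\cdot\tau H$, $H\tau\cdot\nabla H=\nabla H\cdot H\tau$, and both equations with $\tau'$ in place of $\tau$. Weak braided bimonad. Let $\underline H=(H,m,e)$ be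 a monad and $\overline H=(H,\delta,\varepsilon)$ a comonad on $\mathbb A$ with the same endofunctor $H$, and $\tau,\tau'$ a weak YB-pair, $\nabla=\tau\cdot\tau'$. $\mathbf H=(\underline H,\overline H,\tau)$ is a weak braided bimonad if (1) $m\cdot\nabla=m$, $\nabla\cdot\delta=\delta$; (2) $\nabla\cdot He=\tau\cdot eH$, $H\varepsilon\cdot\nabla=\varepsilon H\cdot\tau$, $\nabla\cdot eH=\tau\cdot He$, $\varepsilon H\cdot\nabla=H\varepsilon\cdot\tau$; (3) $\delta H\cdot\tau=H\tau\cdot\tau H\cdot H\delta$, $\tau\cdot mH=Hm\cdot\tau H\cdot H\tau$; (4) $H\delta\cdot\tau=\tau H\cdot H\tau\cdot\delta H$, $\tau\cdot Hm=mH\cdot H\tau\cdot\tau H$; (5) $\delta\cdot m=mm\cdot H\tau H\cdot\delta\delta$; (6) $\varepsilon\varepsilon\cdot mm\cdot H\delta H=\varepsilon\cdot m\cdot mH=\varepsilon\varepsilon\cdot mm\cdot H\tau'H\cdot H\delta H$; (7) $HmH\cdot\delta\delta\cdot ee=\delta H\cdot\delta\cdot e=HmH\cdot H\tau'H\cdot\delta\delta\cdot ee$. $H^{\bar\xi}$. Put $\overline\omega:=Hm\cdot\tau H\cdot H\delta:HH\to HH$ and $\bar\xi:=H\varepsilon\cdot\overline\omega\cdot He:H\to H$. $\bar\xi$ is idempotent; let $\bar\xi=\iota^{\bar\xi}\cdot q^{\bar\xi}$, $q^{\bar\xi}\cdot\iota^{\bar\xi}=1$ be a splitting through $H^{\bar\xi}$.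 Then $m^{\bar\xi}:=q^{\bar\xi}\cdot m\cdot(\iota^{\bar\xi}\iota^{\bar\xi})$, $e^{\bar\xi}:=q^{\bar\xi}\cdot e$, $\delta_{\bar\xi}:=(q^{\bar\xi}q^{\bar\xi})\cdot\delta\cdot\iota^{\bar\xi}$, $\varepsilon_{\bar\xi}:=\varepsilon\cdot\iota^{\bar\xi}$. *)

(* Defs.v *)
Set Implicit Arguments.
Unset Strict Implicit.
Unset Printing Implicit Defensive.

Record category := Category {
  obj :> Type;
  hom : obj -> obj -> Type;
  idm : forall X, hom X X;
  comp : forall X Y Z, hom Y Z -> hom X Y -> hom X Z;
  comp_idl : forall X Y (f : hom X Y), comp (idm Y) f = f;
  comp_idr : forall X Y (f : hom X Y), comp f (idm X) = f;
  compA : forall X Y Z W (h : hom Z W) (g : hom Y Z) (f : hom X Y),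
    comp h (comp g f) = comp (comp h g) f
}.
Arguments hom {_} _ _.
Arguments idm {_} _.
Arguments comp {_ _ _ _} _ _.

Declare Scope cat_scope.
Delimit Scope cat_scope with cat.
Open Scope cat_scope.

Notation "g ∘ f" := (comp g f) (at level 40, left associativity) : cat_scope.

Definition cauchy_complete (A : category) : Prop :=
  forall (X : A) (f : hom X X), f ∘ f = f ->
    exists (Y : A) (q : hom X Y) (i : hom Y X), i ∘ q = f /\ q ∘ i = idm Y.

(* The action of a functor is kept apart from the functor laws, in a record
   with definitional eta, and natural transformations depend on the action
   only.  So K (G F) and (K G) F, as well as 1 F, F 1 and F, have convertible
   types of natural transformations, and no coherence isomorphisms appear. *)
Set Primitive Projections.
Record functor_data (A B : category) := FunctorData {
  fobj :> A -> B;
  fmap : forall X Y, hom X Y -> hom (fobj X) (fobj Y)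
}.
Unset Primitive Projections.
Arguments fmap {_ _} _ {_ _} _.

Record functor (A B : category) := Functor {
  fdata :> functor_data A B;
  fmap_id : forall X, fmap fdata (idm X) = idm (fdata X);
  fmap_comp : forall X Y Z (g : hom Y Z) (f : hom X Y),
    fmap fdata (g ∘ f) = fmap fdata g ∘ fmap fdata f
}.

Section FunctorConstructions.
Variables A B C : category.

Definition fid_data : functor_data A A :=
  {| fobj := fun X => X; fmap := fun X Y f => f |}.

Definition fid : functor A A :=
  @Functor A A fid_data (fun X => eq_refl) (fun X Y Z g f => eq_refl).

Definition fcomp_data (G : functor_data B C) (F : functor_data A B) :
  functor_data A C :=
  {| fobj := fun X => G (F X); fmap := fun X Y f => fmap G (fmap F f) |}.

Lemma fcomp_id (G : functor B C) (F : functor A B) X :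
  fmap (fcomp_data G F) (idm X) = idm (fcomp_data G F X).
Proof. simpl. rewrite fmap_id. apply fmap_id. Qed.

Lemma fcomp_comp (G : functor B C) (F : functor A B) X Y Z
    (g : hom Y Z) (f : hom X Y) :
  fmap (fcomp_data G F) (g ∘ f) =
  fmap (fcomp_data G F) g ∘ fmap (fcomp_data G F) f.
Proof. simpl. rewrite fmap_comp. apply fmap_comp. Qed.

Definition fcomp (G : functor B C) (F : functor A B) : functor A C :=
  Functor (fcomp_id G F) (@fcomp_comp G F).
End FunctorConstructions.

Arguments fid {A}.

Notation "G ⊚ F" := (fcomp G F) (at level 40, left associativity) : cat_scope.

Record nattrans (A B : category) (F G : functor_data A B) := NatTrans {
  component :> forall X, hom (F X) (G X);
  naturality : forall X Y (f : hom X Y),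
    fmap G f ∘ component X = component Y ∘ fmap F f
}.

Notation "F ⟹ G" := (nattrans F G) (at level 70, no associativity) : cat_scope.

Definition nt_eq (A B : category) (F G : functor_data A B)
  (phi psi : F ⟹ G) : Prop := forall X, phi X = psi X.

Notation "phi ≡ psi" := (nt_eq phi psi) (at level 70, no associativity)
  : cat_scope.

Section NatTransOperations.

Definition nt_id (A B : category) (F : functor_data A B) : F ⟹ F.
Proof.
refine (@NatTrans A B F F (fun X => idm (F X)) _).
abstract (intros X Y f; rewrite comp_idl; apply comp_idr).
Defined.

Definition vcomp (A B : category) (F G K : functor_data A B)
  (psi : G ⟹ K) (phi : F ⟹ G) : F ⟹ K.
Proof.
refine (@NatTrans A B F K (fun X => psi X ∘ phi X) _).
abstract (intros X Y f;
  rewrite compA, naturality, <- compA, naturality; apply compA).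
Defined.

Definition whisker_l (A B C : category) (K : functor B C)
  (F G : functor A B) (phi : F ⟹ G) : K ⊚ F ⟹ K ⊚ G.
Proof.
refine (@NatTrans A C (K ⊚ F) (K ⊚ G) (fun X => fmap K (phi X)) _).
abstract (intros X Y f; simpl;
  rewrite <- !fmap_comp; f_equal; apply naturality).
Defined.

Definition whisker_r (A B C : category) (F G : functor B C)
  (phi : F ⟹ G) (K : functor A B) : F ⊚ K ⟹ G ⊚ K.
Proof.
refine (@NatTrans A C (F ⊚ K) (G ⊚ K) (fun X => phi (K X)) _).
abstract (intros X Y f; simpl; apply naturality).
Defined.

End NatTransOperations.

Notation "psi ⋅ phi" := (vcomp psi phi) (at level 45, left associativity)
  : cat_scope.
Notation "K ◃ phi" := (whisker_l K phi) (at level 35, right associativity)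
  : cat_scope.
Notation "phi ▹ K" := (whisker_r phi K) (at level 34, left associativity)
  : cat_scope.

Definition hcomp (A B C : category) (F G : functor B C) (F' G' : functor A B)
  (phi : F ⟹ G) (psi : F' ⟹ G') : F ⊚ F' ⟹ G ⊚ G' :=
  (phi ▹ G') ⋅ (F ◃ psi).

Notation "phi ⋆ psi" := (hcomp phi psi) (at level 35, right associativity)
  : cat_scope.

Section Monads.
Variable A : category.

Record is_monad (T : functor A A) (m : T ⊚ T ⟹ T) (e : fid ⟹ T) : Prop := {
  monad_assoc : m ⋅ m ▹ T ≡ m ⋅ T ◃ m;
  monad_unit_l : m ⋅ e ▹ T ≡ nt_id T;
  monad_unit_r : m ⋅ T ◃ e ≡ nt_id T
}.

Record is_comonad (T : functor A A) (d : T ⟹ T ⊚ T) (eps : T ⟹ fid) : Prop := {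
  comonad_coassoc : d ▹ T ⋅ d ≡ T ◃ d ⋅ d;
  comonad_counit_l : eps ▹ T ⋅ d ≡ nt_id T;
  comonad_counit_r : T ◃ eps ⋅ d ≡ nt_id T
}.

Record frobenius_separable (T : functor A A) (m : T ⊚ T ⟹ T) (e : fid ⟹ T)
  (d : T ⟹ T ⊚ T) (eps : T ⟹ fid) : Prop := {
  frob_monad : is_monad m e;
  frob_comonad : is_comonad d eps;
  frob_l : T ◃ m ⋅ d ▹ T ≡ d ⋅ m;
  frob_r : d ⋅ m ≡ m ▹ T ⋅ T ◃ d;
  frob_separable : m ⋅ d ≡ nt_id T
}.

Record is_splitting (T S : functor A A) (phi : T ⟹ T) (q : T ⟹ S)
  (i : S ⟹ T) : Prop := {
  splitting_factor : phi ≡ i ⋅ q;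
  splitting_retract : q ⋅ i ≡ nt_id S
}.

End Monads.

Section WeakBraidedBimonads.
Variables (A : category) (H : functor A A).

Record weak_YB_pair (tau tau' : H ⊚ H ⟹ H ⊚ H) : Prop := {
  yb_regular : tau ⋅ tau' ⋅ tau ≡ tau;
  yb_regular' : tau' ⋅ tau ⋅ tau' ≡ tau';
  yb_commute : tau ⋅ tau' ≡ tau' ⋅ tau;
  yb_braid : H ◃ tau ⋅ tau ▹ H ⋅ H ◃ tau ≡ tau ▹ H ⋅ H ◃ tau ⋅ tau ▹ H;
  yb_braid' :
    H ◃ tau' ⋅ tau' ▹ H ⋅ H ◃ tau' ≡ tau' ▹ H ⋅ H ◃ tau' ⋅ tau' ▹ H;
  yb_nabla_l : tau ▹ H ⋅ H ◃ (tau ⋅ tau') ≡ H ◃ (tau ⋅ tau') ⋅ tau ▹ H;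
  yb_nabla_r : H ◃ tau ⋅ (tau ⋅ tau') ▹ H ≡ (tau ⋅ tau') ▹ H ⋅ H ◃ tau;
  yb_nabla_l' : tau' ▹ H ⋅ H ◃ (tau ⋅ tau') ≡ H ◃ (tau ⋅ tau') ⋅ tau' ▹ H;
  yb_nabla_r' : H ◃ tau' ⋅ (tau ⋅ tau') ▹ H ≡ (tau ⋅ tau') ▹ H ⋅ H ◃ tau'
}.

Variables (m : H ⊚ H ⟹ H) (e : fid ⟹ H) (d : H ⟹ H ⊚ H) (eps : H ⟹ fid).

Record weak_braided_bimonad (tau tau' : H ⊚ H ⟹ H ⊚ H) : Prop := {
  wbb_monad : is_monad m e;
  wbb_comonad : is_comonad d eps;
  wbb_YB : weak_YB_pair tau tau';
  wbb_m_nabla : m ⋅ (tau ⋅ tau') ≡ m;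
  wbb_nabla_d : (tau ⋅ tau') ⋅ d ≡ d;
  wbb_nabla_He : (tau ⋅ tau') ⋅ H ◃ e ≡ tau ⋅ e ▹ H;
  wbb_Heps_nabla : H ◃ eps ⋅ (tau ⋅ tau') ≡ eps ▹ H ⋅ tau;
  wbb_nabla_eH : (tau ⋅ tau') ⋅ e ▹ H ≡ tau ⋅ H ◃ e;
  wbb_epsH_nabla : eps ▹ H ⋅ (tau ⋅ tau') ≡ H ◃ eps ⋅ tau;
  wbb_dH_tau : d ▹ H ⋅ tau ≡ H ◃ tau ⋅ tau ▹ H ⋅ H ◃ d;
  wbb_tau_mH : tau ⋅ m ▹ H ≡ H ◃ m ⋅ tau ▹ H ⋅ H ◃ tau;
  wbb_Hd_tau : H ◃ d ⋅ tau ≡ tau ▹ H ⋅ H ◃ tau ⋅ d ▹ H;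
  wbb_tau_Hm : tau ⋅ H ◃ m ≡ m ▹ H ⋅ H ◃ tau ⋅ tau ▹ H;
  wbb_d_m : d ⋅ m ≡ m ⋆ m ⋅ H ◃ tau ▹ H ⋅ d ⋆ d;
  wbb_eps_m : eps ⋆ eps ⋅ m ⋆ m ⋅ H ◃ d ▹ H ≡ eps ⋅ m ⋅ m ▹ H;
  wbb_eps_m' :
    eps ⋅ m ⋅ m ▹ H ≡ eps ⋆ eps ⋅ m ⋆ m ⋅ H ◃ tau' ▹ H ⋅ H ◃ d ▹ H;
  wbb_d_e : H ◃ m ▹ H ⋅ d ⋆ d ⋅ e ⋆ e ≡ d ▹ H ⋅ d ⋅ e;
  wbb_d_e' :
    d ▹ H ⋅ d ⋅ e ≡ H ◃ m ▹ H ⋅ H ◃ tau' ▹ H ⋅ d ⋆ d ⋅ e ⋆ e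
}.

Definition omega_bar (tau : H ⊚ H ⟹ H ⊚ H) : H ⊚ H ⟹ H ⊚ H :=
  H ◃ m ⋅ tau ▹ H ⋅ H ◃ d.

Definition xi_bar (tau : H ⊚ H ⟹ H ⊚ H) : H ⟹ H :=
  H ◃ eps ⋅ omega_bar tau ⋅ H ◃ e.

Variables (S : functor A A) (q : H ⟹ S) (i : S ⟹ H).

Definition split_mul : S ⊚ S ⟹ S := q ⋅ m ⋅ i ⋆ i.
Definition split_unit : fid ⟹ S := q ⋅ e.
Definition split_comul : S ⟹ S ⊚ S := q ⋆ q ⋅ d ⋅ i.
Definition split_counit : S ⟹ fid := eps ⋅ i.

End WeakBraidedBimonads.

(* Main.v *)
(* Write [xi] for [xi_bar]; in the unbraided case [xi x = 1_1 eps (x 1_2)] in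
   Sweedler notation, the projection of a weak bialgebra onto its source base
   algebra.  The axioms on [d⋅e] give
   [d (xi x) = 1_1 ⊗ 1_2 (xi x)] and [xi 1_1 ⊗ 1_2 = 1_1 ⊗ 1_2], so the image
   of [xi] is a left coideal, and [d (x y) = x_1 ⊗ x_2 y] for [y] in the image.
   Applying [H eps], the image is closed under multiplication.  Compatibility
   of [d] with [m] gives [x_1 (xi x_2) = x], hence separability.  All data and
   axioms, and [xi] itself, are self-dual, so passing to the opposite category
   gives the comonad, the second Frobenius identity, and
   [xi (xi x y) = xi (x y)], which the first Frobenius identity needs.
   The braiding only adds factors [nabla = tau⋅tau'], and these commute with
   [d] (lemma [d_nabla]) and are absorbed by [m], [d] and [tau']. *)

Require Import Defs.

Set Implicit Arguments.
Unset Strict Implicit.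
Unset Printing Implicit Defensive.

Lemma comp_eq (A : category) (X Y Z : A) (k : hom Y Z) (f g : hom X Y) :
  f = g -> k ∘ f = k ∘ g.
Proof. now intros ->. Qed.

Lemma fmap_eq (A B : category) (F : functor A B) (X Y : A) (f g : hom X Y) :
  f = g -> fmap F f = fmap F g.
Proof. now intros ->. Qed.

Ltac flatten := cbn; rewrite ?fmap_comp, ?fmap_id, ?compA, ?comp_idl, ?comp_idr.

Ltac flatten_in E :=
  cbn in E; rewrite ?fmap_comp, ?fmap_id, ?compA, ?comp_idl, ?comp_idr in E.

(* Rewrites with the equation [E] inside a left-nested composite, where its
   left-hand side need not be a subterm. *)
Ltac rw E :=
  let R := fresh in
  pose proof E as R; flatten_in R; cbn;
  first
  [ match type of R with
    | @eq (@hom ?A ?X ?Y) _ _ =>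
      let R' := constr:(fun (Z : A) (k : hom Y Z) =>
        ltac:(let S := fresh in
              pose proof (comp_eq k R) as S; flatten_in S; exact S)) in
      rewrite R'
    end
  | rewrite R ];
  clear R; rewrite ?comp_idl, ?comp_idr.

Ltac rwl E := rw (eq_sym E).

Ltac close_with E :=
  let R := fresh in
  pose proof E as R; flatten_in R; flatten; first [exact R | exact (eq_sym R)].

Arguments xi_bar : simpl never.
Arguments split_mul : simpl never.
Arguments split_comul : simpl never.

(** * Identities for [nabla] and [xi] on [H] *)

Section WeakBraidedBimonad.
Variables (A : category) (H : functor A A).
Variables (m : H ⊚ H ⟹ H) (e : fid ⟹ H) (d : H ⟹ H ⊚ H) (eps : H ⟹ fid).
Variables (tau tau' : H ⊚ H ⟹ H ⊚ H).
Hypothesis bimonad_H : weak_braided_bimonad m e d eps tau tau'.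

Let YB : weak_YB_pair tau tau' := wbb_YB bimonad_H.
Local Notation xi := (xi_bar m e d eps tau).

(** Both sides equal [H ◃ nabla ⋅ d ▹ H ⋅ nabla]: [H ◃ tau ⋅ d ▹ H] has a rightmost factor [tau]
    (equation [S]), and [d ▹ H ⋅ tau] a leftmost factor [H ◃ tau]. *)
Lemma d_nabla X :
  fmap H (tau X) ∘ fmap H (tau' X) ∘ d (H X) = d (H X) ∘ tau X ∘ tau' X.
Proof.
assert (S : fmap H (tau X) ∘ d (H X) = tau' (H X) ∘ fmap H (d X) ∘ tau X).
{ flatten. rw (wbb_Hd_tau bimonad_H X).
  rwl (yb_commute YB (H X)). rwl (yb_nabla_r YB X).
  rw (wbb_nabla_d bimonad_H (H X)). reflexivity. }
transitivity (fmap H (tau X) ∘ fmap H (tau' X) ∘ d (H X) ∘ tau X ∘ tau' X).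
- flatten. rw (fmap_eq H (yb_commute YB X)). flatten. rw S.
  rw (yb_commute YB X). rw (yb_regular YB X). reflexivity.
- flatten. rw (wbb_dH_tau bimonad_H X). rw (fmap_eq H (yb_regular YB X)).
  rwl (wbb_dH_tau bimonad_H X). reflexivity.
Qed.

Lemma tau_de X :
  fmap H (tau X) ∘ tau (H X) ∘ fmap H (d X) ∘ fmap H (e X)
  = d (H X) ∘ tau X ∘ tau' X ∘ e (H X).
Proof.
flatten. rwl (wbb_dH_tau bimonad_H X). rwl (wbb_nabla_eH bimonad_H X).
reflexivity.
Qed.

(** Cancels [H ◃ tau] in [tau_de]: after composing with [H ◃ tau'], the factor [H ◃ nabla] passes
    [tau ▹ H] and is absorbed by [d]. *)
Lemma tau_de' X :
  tau (H X) ∘ fmap H (d X) ∘ fmap H (e X)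
  = fmap H (tau' X) ∘ d (H X) ∘ tau X ∘ tau' X ∘ e (H X).
Proof.
flatten. rwl (tau_de X). rwl (fmap_eq H (yb_commute YB X)).
rwl (yb_nabla_l YB X). rw (fmap_eq H (wbb_nabla_d bimonad_H X)). reflexivity.
Qed.

Lemma xi_barE X :
  xi X = fmap H (eps X) ∘ fmap H (m X) ∘ tau (H X) ∘ fmap H (d X)
         ∘ fmap H (e X).
Proof. unfold xi_bar. flatten. reflexivity. Qed.

Lemma m_tau_e X :
  fmap H (m X) ∘ tau (H X) ∘ e (H (H X)) ∘ tau X ∘ tau' X = tau X ∘ tau' X.
Proof.
flatten. rwl (naturality e (tau X)). rwl (wbb_tau_mH bimonad_H X).
rw (monad_unit_l (wbb_monad bimonad_H) (H X)). reflexivity.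
Qed.

Lemma xi_e X : xi X ∘ e X = e X.
Proof.
rewrite xi_barE. rw (naturality e (e X)). rw (naturality e (d X)).
rwl (wbb_nabla_d bimonad_H X). rw (m_tau_e X). rw (wbb_nabla_d bimonad_H X).
rw (comonad_counit_r (wbb_comonad bimonad_H) X). reflexivity.
Qed.

Lemma m_xi_d X : m X ∘ fmap H (xi X) ∘ d X = idm (H X).
Proof.
rewrite xi_barE. flatten.
rw (naturality d (e X)). rw (naturality d (d X)). rwl (naturality m (eps X)).
rwl (wbb_d_m bimonad_H X). rw (comonad_counit_r (wbb_comonad bimonad_H) X).
rw (monad_unit_r (wbb_monad bimonad_H) X). reflexivity.
Qed.

Lemma d_xi X : d X ∘ xi X = fmap H (m X) ∘ d (H X) ∘ e (H X) ∘ xi X.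
Proof.
rewrite xi_barE.
(* Unbraided, the middle term is [1_1 ⊗ 1_2 1'_1 eps (x 1'_2)]. The left side reaches it by
   [wbb_d_e], the right side by naturality alone. *)
transitivity (fmap H (fmap H (eps X)) ∘ fmap H (fmap H (m X))
  ∘ fmap H (m (H (H X))) ∘ fmap H (fmap H (tau (H X))) ∘ d (H (H (H X)))
  ∘ e (H (H (H X))) ∘ fmap H (d X) ∘ fmap H (e X)); flatten.
- rwl (naturality d (eps X)). rwl (naturality d (m X)).
  rw (wbb_dH_tau bimonad_H (H X)).
  rwl (fmap_eq H (wbb_d_e bimonad_H X)).
  rwl (naturality tau (m (H X))).
  rw (fmap_eq H (wbb_tau_Hm bimonad_H (H X))).
  rw (fmap_eq H (naturality e (d X))).
  rw (tau_de (H (H X))). rwl (d_nabla (H (H X))).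
  rw (fmap_eq H (yb_nabla_r YB (H X))).
  rw (fmap_eq H (wbb_m_nabla bimonad_H (H (H X)))). reflexivity.
- rwl (naturality e (fmap H (eps X))). rwl (naturality e (fmap H (m X))).
  rwl (naturality e (tau (H X))). rwl (naturality d (fmap H (eps X))).
  rwl (naturality d (fmap H (m X))). rwl (naturality d (tau (H X))).
  rw (fmap_eq H (eq_sym (naturality m (eps X)))).
  rw (fmap_eq H (eq_sym (naturality m (m X)))).
  reflexivity.
Qed.

(** [tau_de'] trades the [tau] in [xi] for [tau'], so that [wbb_d_e'] applies. *)
Lemma xi_d_e X : xi (H X) ∘ d X ∘ e X = d X ∘ e X.
Proof.
rewrite xi_barE. rw (tau_de' (H X)). rwl (d_nabla (H X)).
rw (fmap_eq H (yb_regular' YB (H X))).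
rwl (naturality e (d X)). rwl (wbb_d_e' bimonad_H X).
rw (comonad_counit_r (wbb_comonad bimonad_H) (H X)). reflexivity.
Qed.

Lemma xi_d_xi X : xi (H X) ∘ d X ∘ xi X = d X ∘ xi X.
Proof.
rw (d_xi X). rwl (naturality xi (m X)). rw (xi_d_e (H X)).
rwl (d_xi X). reflexivity.
Qed.

(** By [d_xi] and associativity, the left side is [d (x 1)] with its second leg multiplied by
    [xi y]. *)
Lemma d_m_xi X :
  d X ∘ m X ∘ fmap H (xi X) = fmap H (m X) ∘ d (H X) ∘ fmap H (xi X).
Proof.
rw (wbb_d_m bimonad_H X). rw (fmap_eq H (d_xi X)).
rwl (naturality d (fmap H (m X))). rwl (fmap_eq H (naturality tau (m X))).
rwl (fmap_eq H (fmap_eq H (monad_assoc (wbb_monad bimonad_H) X))).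
rwl (naturality m (m X)). rwl (wbb_d_m bimonad_H (H X)).
rw (monad_unit_r (wbb_monad bimonad_H) (H X)). reflexivity.
Qed.

Lemma xi_m_xi_xi X :
  xi X ∘ m X ∘ fmap H (xi X) ∘ xi (H X) = m X ∘ fmap H (xi X) ∘ xi (H X).
Proof.
(* By [d_m_xi] the right factor only enters the second leg; [xi] fixes the first leg by
   [xi_d_xi]. *)
assert (S : xi (H X) ∘ d X ∘ m X ∘ fmap H (xi X) ∘ xi (H X)
            = d X ∘ m X ∘ fmap H (xi X) ∘ xi (H X)).
{ rw (d_m_xi X). rw (naturality xi (xi X)). rwl (naturality xi (m X)).
  rw (xi_d_xi (H X)). rwl (naturality xi (xi X)). rwl (d_m_xi X). reflexivity. }
apply (comp_eq (fmap H (eps X))) in S. flatten_in S. revert S.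
rw (naturality xi (eps X)). rw (comonad_counit_r (wbb_comonad bimonad_H) X).
rw (comonad_counit_r (wbb_comonad bimonad_H) X).
intros ->. reflexivity.
Qed.

End WeakBraidedBimonad.

(** * Duality through the opposite category *)

Definition op_category (A : category) : category :=
  @Category A (fun X Y => @hom A Y X) (@idm A) (fun X Y Z g f => f ∘ g)
    (fun X Y f => comp_idr f) (fun X Y f => comp_idl f)
    (fun X Y Z W h g f => eq_sym (compA f g h)).

Definition op_data (A : category) (F : functor_data A A) :
  functor_data (op_category A) (op_category A) :=
  @FunctorData (op_category A) (op_category A) (fobj F)
    (fun X Y f => fmap F f).

Definition op_functor (A : category) (F : functor A A) :
  functor (op_category A) (op_category A) :=
  @Functor (op_category A) (op_category A) (op_data F)
    (fun X => fmap_id F X) (fun X Y Z g f => fmap_comp F f g).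

(** Dualising preserves composition of functors up to conversion, so [op_nt m] already has the type
    of a comultiplication. *)
Definition op_nt (A : category) (F G : functor_data A A) (phi : F ⟹ G) :
  op_data G ⟹ op_data F :=
  @NatTrans (op_category A) (op_category A) (op_data G) (op_data F)
    (fun X => phi X) (fun X Y f => eq_sym (naturality phi f)).

Lemma op_weak_braided_bimonad (A : category) (H : functor A A)
    (m : H ⊚ H ⟹ H) (e : fid ⟹ H) (d : H ⟹ H ⊚ H) (eps : H ⟹ fid)
    (tau tau' : H ⊚ H ⟹ H ⊚ H) :
  weak_braided_bimonad m e d eps tau tau' ->
  @weak_braided_bimonad (op_category A) (op_functor H)
    (op_nt d) (op_nt eps) (op_nt m) (op_nt e) (op_nt tau) (op_nt tau').
Proof.
intros [[M1 M2 M3] [C1 C2 C3] [Y1 Y2 Y3 Y4 Y5 Y6 Y7 Y8 Y9]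
  B1 B2 B3 B4 B5 B6 B7 B8 B9 B10 B11 B12 B13 B14 B15].
(* Reversal turns [nabla] into [tau' ⋅ tau]; this restores the order. *)
assert (Y3' : forall X, tau' X ∘ tau X = tau X ∘ tau' X)
  by (intro X; symmetry; exact (Y3 X)).
cbn in Y3'.
split; [split | split | split | ..]; intro X; cbn in X |- *.
- close_with (C1 X).
- close_with (C2 X).
- close_with (C3 X).
- close_with (M1 X).
- close_with (M2 X).
- close_with (M3 X).
- close_with (Y1 X).
- close_with (Y2 X).
- close_with (Y3 X).
- close_with (Y4 X).
- close_with (Y5 X).
- rewrite Y3'. close_with (Y6 X).
- rewrite Y3'. close_with (Y7 X).
- rewrite Y3'. close_with (Y8 X).
- rewrite Y3'. close_with (Y9 X).
- rewrite Y3'. close_with (B2 X).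
- rewrite Y3'. close_with (B1 X).
- rewrite Y3'. close_with (B4 X).
- rewrite Y3'. close_with (B3 X).
- rewrite Y3'. close_with (B6 X).
- rewrite Y3'. close_with (B5 X).
- close_with (B8 X).
- close_with (B7 X).
- close_with (B10 X).
- close_with (B9 X).
(* Reversal swaps the two whiskerings in [⋆]; naturality swaps them back. *)
- flatten. rw (naturality m (m X)). rw (naturality d (d X)). close_with (B11 X).
- flatten. rw (naturality d (d X)). rw (naturality e (e X)). close_with (B14 X).
- flatten. rw (naturality d (d X)). rw (naturality e (e X)). close_with (B15 X).
- flatten. rw (naturality eps (eps X)). rw (naturality m (m X)).
  close_with (B12 X).
- flatten. rw (naturality eps (eps X)). rw (naturality m (m X)).
  close_with (B13 X).
Qed.

(** With [m], [d] and [e], [eps] exchanged, the composite defining [xi] reads the same backwards. *)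
Lemma xi_bar_op (A : category) (H : functor A A)
    (m : H ⊚ H ⟹ H) (e : fid ⟹ H) (d : H ⟹ H ⊚ H) (eps : H ⟹ fid)
    (tau : H ⊚ H ⟹ H ⊚ H) (X : A) :
  @xi_bar (op_category A) (op_functor H) (op_nt d) (op_nt eps) (op_nt m)
    (op_nt e) (op_nt tau) X
  = xi_bar m e d eps tau X.
Proof. unfold xi_bar, omega_bar. flatten. reflexivity. Qed.

Lemma xi_m_xi (A : category) (H : functor A A)
    (m : H ⊚ H ⟹ H) (e : fid ⟹ H) (d : H ⟹ H ⊚ H) (eps : H ⟹ fid)
    (tau tau' : H ⊚ H ⟹ H ⊚ H) :
  weak_braided_bimonad m e d eps tau tau' -> forall X,
  xi_bar m e d eps tau X ∘ m X ∘ xi_bar m e d eps tau (H X)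
  = xi_bar m e d eps tau X ∘ m X.
Proof.
intros bimonad_H X.
pose proof (xi_d_xi (op_weak_braided_bimonad bimonad_H) X) as E.
rewrite !xi_bar_op in E.
close_with E.
Qed.

(** * The structure on the splitting of [xi] *)

Section Splitting.
Variables (A : category) (H : functor A A).
Variables (m : H ⊚ H ⟹ H) (e : fid ⟹ H) (d : H ⟹ H ⊚ H) (eps : H ⟹ fid).
Variables (tau tau' : H ⊚ H ⟹ H ⊚ H).
Hypothesis bimonad_H : weak_braided_bimonad m e d eps tau tau'.
Variables (S : functor A A) (q : H ⟹ S) (i : S ⟹ H).
Local Notation xi := (xi_bar m e d eps tau).
Hypothesis xi_splits : is_splitting xi q i.

Let iq X : i X ∘ q X = xi X.
Proof. symmetry. exact (splitting_factor xi_splits X). Qed.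

Let qi X : q X ∘ i X = idm (S X).
Proof. exact (splitting_retract xi_splits X). Qed.

Let xi_i X : xi X ∘ i X = i X.
Proof. rwl (iq X). rw (qi X). reflexivity. Qed.

Let q_xi X : q X ∘ xi X = q X.
Proof. rwl (iq X). rw (qi X). reflexivity. Qed.

Lemma i_inj X Y (f g : hom Y (S X)) : i X ∘ f = i X ∘ g -> f = g.
Proof.
intro E. apply (comp_eq (q X)) in E. flatten_in E. rewrite !qi in E.
flatten_in E. exact E.
Qed.

(** The factor [i ⋅ q = xi] disappears because the image of [xi] is closed under multiplication. *)
Lemma i_split_mul X : i X ∘ split_mul m q i X = m X ∘ fmap H (i X) ∘ i (S X).
Proof.
assert (E : m X ∘ fmap H (i X) ∘ i (S X)
  = m X ∘ fmap H (xi X) ∘ xi (H X) ∘ fmap H (i X) ∘ i (S X)).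
{ flatten. rwl (naturality xi (i X)). rw (xi_i (S X)). rw (fmap_eq H (xi_i X)).
  reflexivity. }
unfold split_mul. flatten. rewrite iq. rwl (naturality i (i X)). rw E.
rw (xi_m_xi_xi bimonad_H X). rwl E. reflexivity.
Qed.

Lemma split_mul_q X :
  split_mul m q i X ∘ q (S X) = q X ∘ m X ∘ fmap H (i X).
Proof.
unfold split_mul. flatten. rw (naturality q (i X)). rw (iq (H X)).
rwl (q_xi X). rw (xi_m_xi bimonad_H X). rw (q_xi X). reflexivity.
Qed.

(** [i] is monic and, by [i_split_mul] and [xi_e], respects product and unit, so the laws come from
    [H]. *)
Lemma split_monad : is_monad (split_mul m q i) (split_unit e q).
Proof.
split; intro X; apply i_inj; flatten; rw (i_split_mul X).
- rw (i_split_mul (S X)). rwl (naturality i (split_mul m q i X)).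
  rw (fmap_eq H (i_split_mul X)). rw (naturality m (i X)).
  rw (monad_assoc (wbb_monad bimonad_H) X). reflexivity.
- rw (iq (S X)). rw (xi_e bimonad_H (S X)). rw (naturality e (i X)).
  rw (monad_unit_l (wbb_monad bimonad_H) X). reflexivity.
- rwl (naturality i (q X)). rwl (naturality i (e X)). rw (fmap_eq H (iq X)).
  rw (fmap_eq H (xi_e bimonad_H X)).
  rw (monad_unit_r (wbb_monad bimonad_H) X). reflexivity.
Qed.

Lemma split_separable : split_mul m q i ⋅ split_comul d q i ≡ nt_id S.
Proof.
intro X. apply i_inj. flatten. rw (i_split_mul X). unfold split_comul. flatten.
rw (iq (S X)). rwl (naturality xi (q X)). rw (fmap_eq H (iq X)).
(* Writing [i] as [xi ⋅ i] lets [xi_d_xi] absorb the [xi] on the first leg; [m_xi_d] uses the one on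
   the second. *)
rwl (xi_i X). rw (xi_d_xi bimonad_H X). rw (m_xi_d bimonad_H X). rw (xi_i X).
reflexivity.
Qed.

Lemma split_frobenius_l :
  S ◃ split_mul m q i ⋅ split_comul d q i ▹ S
  ≡ split_comul d q i ⋅ split_mul m q i.
Proof.
intro X. flatten. unfold split_comul. flatten.
rw (naturality q (split_mul m q i X)). rw (fmap_eq H (split_mul_q X)).
rw (i_split_mul X). rw (naturality d (i X)).
(* The inserted [xi] marks the right factor as an image element, as [d_m_xi] requires. *)
rwl (fmap_eq H (xi_i X)).
rwl (d_m_xi bimonad_H X). rw (fmap_eq H (xi_i X)). reflexivity.
Qed.

End Splitting.

(** * Duality for the split structure *)

Lemma split_mul_op (A : category) (H S : functor A A) (d : H ⟹ H ⊚ H)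
    (q : H ⟹ S) (i : S ⟹ H) (X : A) :
  @split_mul (op_category A) (op_functor H) (op_nt d) (op_functor S)
    (op_nt i) (op_nt q) X
  = split_comul d q i X.
Proof.
unfold split_mul, split_comul. flatten. rw (naturality q (q X)). reflexivity.
Qed.

Lemma split_comul_op (A : category) (H S : functor A A) (m : H ⊚ H ⟹ H)
    (q : H ⟹ S) (i : S ⟹ H) (X : A) :
  @split_comul (op_category A) (op_functor H) (op_nt m) (op_functor S)
    (op_nt i) (op_nt q) X
  = split_mul m q i X.
Proof.
unfold split_mul, split_comul. flatten. rwl (naturality i (i X)). reflexivity.
Qed.

Lemma op_splitting (A : category) (H S : functor A A) (phi : H ⟹ H)
    (psi : @nattrans (op_category A) (op_category A)
             (op_functor H) (op_functor H))
    (q : H ⟹ S) (i : S ⟹ H) :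
  (forall X, psi X = phi X) -> is_splitting phi q i ->
  @is_splitting (op_category A) (op_functor H) (op_functor S) psi
    (op_nt i) (op_nt q).
Proof.
intros E [F R]. split; intro X.
- rewrite E. exact (F X).
- exact (R X).
Qed.

Theorem proposition6p11 (A : category) (A_cauchy : cauchy_complete A)
  (H : functor A A)
  (m : H ⊚ H ⟹ H) (e : fid ⟹ H) (d : H ⟹ H ⊚ H) (eps : H ⟹ fid)
  (tau tau' : H ⊚ H ⟹ H ⊚ H)
  (bimonad_H : weak_braided_bimonad m e d eps tau tau')
  (Hxi : functor A A) (q : H ⟹ Hxi) (i : Hxi ⟹ H)
  (xi_splits : is_splitting (xi_bar m e d eps tau) q i) :
  frobenius_separable
    (split_mul m q i) (split_unit e q) (split_comul d q i) (split_counit eps i).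
Proof.
pose proof (op_weak_braided_bimonad bimonad_H) as bimonad_op.
pose proof (op_splitting (xi_bar_op m e d eps tau) xi_splits) as splits_op.
(* Read in [A], the dual monad laws are the comonad laws, and the dual of [frob_l] is [frob_r]. *)
destruct (split_monad bimonad_op splits_op) as [coassoc counit_l counit_r].
pose proof (split_frobenius_l bimonad_op splits_op) as frobenius_r.
split; [ | split | | | ].
- exact (split_monad bimonad_H xi_splits).
- intro X. flatten. rewrite <- !split_mul_op. close_with (coassoc X).
- intro X. flatten. rewrite <- !split_mul_op. close_with (counit_l X).
- intro X. flatten. rewrite <- !split_mul_op. close_with (counit_r X).
- exact (split_frobenius_l bimonad_H xi_splits).
- intro X. flatten. rewrite <- split_mul_op, <- !(split_comul_op m q i).
  close_with (frobenius_r X).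
- exact (split_separable bimonad_H xi_splits).
Qed.
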